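(* Let $K$ be a knot in an integral homology $3$-sphere $\Sigma$ with exterior $E_K$, let $n\ge2$ and $0\le k\le n$ be integers, and let $\rho:\pi_1(E_K)\to\mathrm{SL}_2(\mathbb C)$ be a representation with $\mathrm{tr}\,\rho(\mu)=2\cos(k\pi/n)$ and $\rho(\mu)^n=(-\mathbf 1)^k$. Then the representation $\Phi(\rho):\pi_1(C_n)\to\mathrm{SL}_2(\mathbb C)$ defined by $$\Phi(\rho)(\gamma)=\bigl((\zeta_{2n})^{[p_*(\gamma)]}\bigr)^k\,\rho(p_*(\gamma)),\qquad \zeta_{2n}=\exp(\pi\sqrt{-1}/n),$$ satisfies $\Phi(\rho)(\mu_n)=\mathbf 1$. In particular, $\Phi(\rho)$ induces a homomorphism from $\pi_1(C_n)/\langle\langle\mu_n\rangle\rangle$ into $\mathrm{SL}_2(\mathbb C)$.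
   Context: $E_K$ is the complement of an open tubular neighbourhood of $K$ in $\Sigma$; $\mu\in\pi_1(E_K)$ is a meridian. $p:C_n\to E_K$ is the $n$-fold cyclic cover, $p_*$ the induced map on $\pi_1$, and $\mu_n\in\pi_1(C_n)$ is the meridian with $p_*(\mu_n)=\mu^n$. $\langle\langle\mu_n\rangle\rangle$ is the normal closure of $\mu_n$; the quotient $\pi_1(C_n)/\langle\langle\mu_n\rangle\rangle$ is $\pi_1(B_n)$, where $B_n$ is the $n$-fold cyclic branched cover of $\Sigma$ along $K$. For $g\in\pi_1(E_K)$, $[g]\in H_1(E_K;\mathbb Z)\cong\mathbb Z$ is its homology class, with $[\mu]=1$; for $\gamma\in\pi_1(C_n)$ one has $[p_*(\gamma)]\in n\mathbb Z$. $\mathbf 1$ is the identity matrix. *)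

(* Defs.v *)
From HB Require Import structures.
From mathcomp Require Import all_boot all_order all_algebra generic_quotient ring_quotient.
From mathcomp Require Import freeg complex.
From mathcomp Require Import all_classical all_reals all_analysis.
From mathcomp Require Import homotopy lra.
Import Order.TTheory GRing.Theory Num.Theory numFieldNormedType.Exports.

Set Implicit Arguments.
Unset Strict Implicit.
Unset Printing Implicit Defensive.

Local Open Scope classical_set_scope.
Local Open Scope ring_scope.
Local Open Scope quotient_scope.

Lemma continuous_paste (X Y : topologicalType) (A B : set X) (f g k : X -> Y) :
  closed A -> closed B -> A `|` B = setT -> continuous g -> continuous k ->
  (forall x, A x -> f x = g x) -> (forall x, B x -> f x = k x) -> continuous f.
Proof.
move=> cA cB AB /continuous_closedP cg /continuous_closedP ck fg fk.
apply/continuous_closedP => C cC.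
have -> : f @^-1` C = (A `&` g @^-1` C) `|` (B `&` k @^-1` C).
  apply/seteqP; split => x /=.
    have [Ax|Bx] : (A `|` B) x by rewrite AB.
      by move=> Cf; left; split=> //; rewrite -fg.
    by move=> Cf; right; split=> //; rewrite -fk.
  by case=> -[h]; [rewrite -fg|rewrite -fk].
by apply: closedU; apply: closedI => //; [exact: cg|exact: ck].
Qed.

Section UnitInterval.
Context {R : realType}.

Definition unitI : Type := set_type (`[0, 1]%classic : set R).

HB.instance Definition _ := Topological.on unitI.

Definition clamp_val (t : R) : R := Num.max 0 (Num.min t 1).

Lemma clamp_subproof t : clamp_val t \in (`[0, 1]%classic : set R).
Proof.
rewrite /clamp_val; apply/mem_set; rewrite /= in_itv /= le_max lexx /=.
by rewrite ge_max ler01 ge_min lexx orbT.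
Qed.

Definition clamp (t : R) : unitI := exist _ (clamp_val t) (clamp_subproof t).

Lemma unitI_itv (t : unitI) : 0 <= set_val t <= 1.
Proof. by have /= := set_valP t; rewrite in_itv. Qed.

Lemma val_clamp (t : R) : 0 <= t <= 1 -> set_val (clamp t) = t.
Proof.
by case/andP=> t0 t1; rewrite set_valE /= /clamp_val (min_idPl t1) (max_idPr t0).
Qed.

Lemma clampK (t : unitI) : clamp (set_val t) = t.
Proof. by apply: val_inj; rewrite -[LHS]/(set_val _) val_clamp // unitI_itv. Qed.

Lemma clamp_continuous : continuous clamp.
Proof.
apply: continuous_comp_initial => t /=.
apply: (@continuous_max _ _ (cst 0) (fun t : R => Num.min t 1)); first exact: cvg_cst.
apply: (@continuous_min _ _ id (cst 1)); [exact: cvg_id|exact: cvg_cst].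
Qed.

Lemma val_unitI_continuous : continuous (set_val : unitI -> R).
Proof. exact: initial_continuous. Qed.

Lemma clamp01_neq : clamp 0 != clamp 1.
Proof.
apply/eqP => /(congr1 set_val); rewrite !val_clamp ?lexx ?ler01 //.
by move/eqP; rewrite eq_sym oner_eq0.
Qed.

HB.instance Definition _ := isBiPointed.Build unitI clamp01_neq.

Lemma unitI0 : (zero : unitI) = clamp 0. Proof. by []. Qed.
Lemma unitI1 : (one : unitI) = clamp 1. Proof. by []. Qed.
End UnitInterval.
Arguments unitI : clear implicits.

Lemma cts_comp (X Y Z : topologicalType) (f : X -> Y) (g : Y -> Z) :
  continuous f -> continuous g -> continuous (fun x => g (f x)).
Proof. by move=> cf cg x; apply: (continuous_comp (cf x)); exact: cg. Qed.

Lemma cts_pair (X Y Z : topologicalType) (f : X -> Y) (g : X -> Z) :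
  continuous f -> continuous g -> continuous (fun x => (f x, g x)).
Proof. by move=> cf cg x; apply: cvg_pair; [exact: cf|exact: cg]. Qed.

Lemma cts_fst (X Y Z : topologicalType) (f : X -> Z) :
  continuous f -> continuous (fun xy : X * Y => f xy.1).
Proof. by move=> cf; apply: (@cts_comp _ _ _ fst) => // ?; exact: cvg_fst. Qed.

Lemma cts_snd (X Y Z : topologicalType) (f : Y -> Z) :
  continuous f -> continuous (fun xy : X * Y => f xy.2).
Proof. by move=> cf; apply: (@cts_comp _ _ _ snd) => // ?; exact: cvg_snd. Qed.

Lemma cts_id (X : topologicalType) : continuous (fun x : X => x).
Proof. by move=> x; exact: cvg_id. Qed.

Section Paths.
Context {R : realType} {X : topologicalType}.
Local Notation I := (unitI R).
Local Notation path := (@pathType I X).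

Definition path_concat_fun {x y z : X} (f : path x y) (g : path y z) (t : I) : X :=
  if set_val t <= 2^-1 then f (clamp (2 * set_val t))
  else g (clamp (2 * set_val t - 1)).

Lemma affine_unitI_continuous (a b : R) : continuous (fun t : I => a * set_val t + b).
Proof.
move=> t; apply: (@continuousD _ _ _ (fun t : I => a * set_val t) (cst b)).
  apply: (@continuousM _ _ (cst a)); first exact: cst_continuous.
  exact: val_unitI_continuous.
exact: cst_continuous.
Qed.

Lemma scale_clamp_continuous (a b : R) :
  continuous (fun t : I => clamp (a * set_val t + b) : I).
Proof.
apply: (@cts_comp _ _ _ _ clamp); last exact: clamp_continuous.
exact: affine_unitI_continuous.
Qed.

Section Concat.
Context {x y z : X} (f : path x y) (g : path y z).

Lemma path_concat_continuous : continuous (path_concat_fun f g).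
Proof.
pose s (t : I) : R := set_val t.
have cs : continuous s by exact: val_unitI_continuous.
apply: (@continuous_paste _ _ (s @^-1` [set r | r <= 2^-1]) (s @^-1` [set r | 2^-1 <= r])
  _ (fun t => f (clamp (2 * s t + 0))) (fun t => g (clamp (2 * s t + -1)))).
- by apply: preimage_closed => //; exact: closed_le.
- by apply: preimage_closed => //; exact: closed_ge.
- by apply/seteqP; split => // t _ /=; have [|/ltW] := leP (s t) 2^-1; [left|right].
- by apply: (@cts_comp _ _ _ _ f); [exact: scale_clamp_continuous|exact: cts_fun].
- by apply: (@cts_comp _ _ _ _ g); [exact: scale_clamp_continuous|exact: cts_fun].
- by move=> t /= h; rewrite /path_concat_fun h addr0.
- move=> t /= h; rewrite /path_concat_fun -/(s t); case: (leP _ (2^-1 : R)) => // h'.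
  have -> : s t = 2^-1 by apply/eqP; rewrite eq_le h' h.
  by rewrite mulfV ?pnatr_eq0// subrr -unitI0 -unitI1 path_zero path_one.
Qed.

Lemma path_concat0 : path_concat_fun f g zero = x.
Proof.
rewrite /path_concat_fun unitI0 val_clamp ?lexx ?ler01 //.
by rewrite invr_ge0 ler0n mulr0 -unitI0 path_zero.
Qed.

Lemma path_concat1 : path_concat_fun f g one = z.
Proof.
rewrite /path_concat_fun unitI1 val_clamp ?lexx ?ler01 //.
case: (leP _ (2^-1 : R)) => [?|_]; first by exfalso; lra.
have -> : (2 * 1 - 1 : R) = 1 by lra.
by rewrite -unitI1 path_one.
Qed.

Definition path_concat : path x z :=
  mk_path path_concat_continuous path_concat0 path_concat1.

Lemma path_concatE t : path_concat t =
  if set_val t <= 2^-1 then f (clamp (2 * set_val t))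
  else g (clamp (2 * set_val t - 1)).
Proof. by []. Qed.

End Concat.

Section Reverse.
Context {x y : X} (f : path x y).

Definition path_rev_fun (t : I) : X := f (clamp (1 - set_val t)).

Lemma path_rev_continuous : continuous path_rev_fun.
Proof.
have -> : path_rev_fun = fun t => f (clamp (-1 * set_val t + 1)).
  by apply/funext => t; rewrite /path_rev_fun mulN1r addrC.
by apply: (@cts_comp _ _ _ _ f); [exact: scale_clamp_continuous|exact: cts_fun].
Qed.

Lemma path_rev0 : path_rev_fun zero = y.
Proof.
by rewrite /path_rev_fun unitI0 val_clamp ?lexx ?ler01 // subr0 -unitI1 path_one.
Qed.

Lemma path_rev1 : path_rev_fun one = x.
Proof.
by rewrite /path_rev_fun unitI1 val_clamp ?lexx ?ler01 // subrr -unitI0 path_zero.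
Qed.

Definition path_rev : path y x := mk_path path_rev_continuous path_rev0 path_rev1.

Lemma path_revE t : path_rev t = f (clamp (1 - set_val t)).
Proof. by []. Qed.
End Reverse.

Definition path_const (x : X) : path x x := cst x.

Definition path_homotopic {x y : X} (f g : path x y) : Prop :=
  exists H : I * I -> X, [/\ continuous H,
    forall s, H (s, zero) = f s, forall s, H (s, one) = g s,
    forall t, H (zero, t) = x & forall t, H (one, t) = y].

Lemma path_homotopic_refl x y (f : path x y) : path_homotopic f f.
Proof.
exists (f \o fst); split => //= [|t|t]; rewrite ?path_zero ?path_one //.
by apply: cts_fst; exact: cts_fun.
Qed.

Lemma path_homotopic_sym x y (f g : path x y) :
  path_homotopic f g -> path_homotopic g f.
Proof.
case=> H [cH H0 H1 Hx Hy].
exists (fun st => H (st.1, clamp (-1 * set_val st.2 + 1))); split => /=.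
- apply: (@cts_comp _ _ _ (fun st : I * I => (st.1, clamp (-1 * set_val st.2 + 1))) H) => //.
  apply: cts_pair; first exact: (@cts_fst I I I id (@cts_id I)).
  by apply: (@cts_snd _ _ _ (fun t : I => clamp (-1 * set_val t + 1)));
    exact: scale_clamp_continuous.
- by move=> s; rewrite unitI0 val_clamp ?lexx ?ler01 // mulr0 add0r -unitI1 H1.
- by move=> s; rewrite unitI1 val_clamp ?lexx ?ler01 // mulr1 addNr -unitI0.
- by [].
- by [].
Qed.

Lemma path_homotopic_trans x y (g f k : path x y) :
  path_homotopic f g -> path_homotopic g k -> path_homotopic f k.
Proof.
case=> H [cH H0 H1 Hx Hy] [K [cK K0 K1 Kx Ky]].
pose s (st : I * I) : R := set_val st.2.
have cs : continuous s.
  by apply: cts_snd; exact: val_unitI_continuous.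
exists (fun st => if s st <= 2^-1 then H (st.1, clamp (2 * s st))
   else K (st.1, clamp (2 * s st - 1))); split => /=.
- have cc (L : I * I -> X) (b : R) : continuous L ->
      continuous (fun st => L (st.1, clamp (2 * s st + b))).
    move=> cL; apply: (@cts_comp _ _ _
       (fun st : I * I => (st.1, clamp (2 * s st + b))) L) => //.
    apply: cts_pair; first exact: (@cts_fst I I I id (@cts_id I)).
    by apply: (@cts_snd _ _ _ (fun t : I => clamp (2 * set_val t + b)));
      exact: scale_clamp_continuous.
  apply: (@continuous_paste _ _ (s @^-1` [set r | r <= 2^-1]) (s @^-1` [set r | 2^-1 <= r])
    _ (fun st => H (st.1, clamp (2 * s st + 0))) (fun st => K (st.1, clamp (2 * s st + -1)))).
  + by apply: preimage_closed => //; exact: closed_le.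
  + by apply: preimage_closed => //; exact: closed_ge.
  + by apply/seteqP; split => // t _ /=; have [|/ltW] := leP (s t) 2^-1; [left|right].
  + exact: cc.
  + exact: cc.
  + by move=> t /= h; rewrite h addr0.
  + move=> t /= h; case: (leP _ (2^-1 : R)) => // h'.
    have -> : s t = 2^-1 by apply/eqP; rewrite eq_le h' h.
    by rewrite mulfV ?pnatr_eq0// subrr -unitI0 -unitI1 K0 H1.
- move=> u; rewrite /s /= val_clamp ?lexx ?ler01 // invr_ge0 ler0n.
  by rewrite mulr0 -unitI0.
- move=> u; rewrite /s /= val_clamp ?lexx ?ler01 //.
  case: (leP _ (2^-1 : R)) => [?|_]; first by exfalso; lra.
  have -> : (2 * 1 - 1 : R) = 1 by lra.
  by rewrite -unitI1.
- by move=> t; case: ifP.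
- by move=> t; case: ifP.
Qed.

Lemma path_concat_homotopic x y z (f f' : path x y) (g g' : path y z) :
  path_homotopic f f' -> path_homotopic g g' ->
  path_homotopic (path_concat f g) (path_concat f' g').
Proof.
case=> H [cH H0 H1 Hx Hy] [K [cK K0 K1 Kx Ky]].
pose s (st : I * I) : R := set_val st.1.
have cs : continuous s.
  by apply: cts_fst; exact: val_unitI_continuous.
exists (fun st => if s st <= 2^-1 then H (clamp (2 * s st), st.2)
   else K (clamp (2 * s st - 1), st.2)); split => /=.
- have cc (L : I * I -> X) (b : R) : continuous L ->
      continuous (fun st => L (clamp (2 * s st + b), st.2)).
    move=> cL; apply: (@cts_comp _ _ _
       (fun st : I * I => (clamp (2 * s st + b), st.2)) L) => //.
    apply: cts_pair; last exact: (@cts_snd I I I id (@cts_id I)).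
    by apply: (@cts_fst _ _ _ (fun t : I => clamp (2 * set_val t + b)));
      exact: scale_clamp_continuous.
  apply: (@continuous_paste _ _ (s @^-1` [set r | r <= 2^-1]) (s @^-1` [set r | 2^-1 <= r])
    _ (fun st => H (clamp (2 * s st + 0), st.2)) (fun st => K (clamp (2 * s st + -1), st.2))).
  + by apply: preimage_closed => //; exact: closed_le.
  + by apply: preimage_closed => //; exact: closed_ge.
  + by apply/seteqP; split => // t _ /=; have [|/ltW] := leP (s t) 2^-1; [left|right].
  + exact: cc.
  + exact: cc.
  + by move=> t /= h; rewrite h addr0.
  + move=> t /= h; case: (leP _ (2^-1 : R)) => // h'.
    have -> : s t = 2^-1 by apply/eqP; rewrite eq_le h' h.
    by rewrite mulfV ?pnatr_eq0// subrr -unitI0 -unitI1 Kx Hy.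
- by move=> u; rewrite /mk_path /path_concat_fun /s /=; case: ifP.
- by move=> u; rewrite /mk_path /path_concat_fun /s /=; case: ifP.
- move=> t; rewrite /s /= val_clamp ?lexx ?ler01 // invr_ge0 ler0n.
  by rewrite mulr0 -unitI0.
- move=> t; rewrite /s /= val_clamp ?lexx ?ler01 //.
  case: (leP _ (2^-1 : R)) => [?|_]; first by exfalso; lra.
  have -> : (2 * 1 - 1 : R) = 1 by lra.
  by rewrite -unitI1.
Qed.

Lemma path_rev_homotopic x y (f g : path x y) :
  path_homotopic f g -> path_homotopic (path_rev f) (path_rev g).
Proof.
case=> H [cH H0 H1 Hx Hy].
exists (fun st => H (clamp (-1 * set_val st.1 + 1), st.2)); split => /=.
- apply: (@cts_comp _ _ _ (fun st : I * I => (clamp (-1 * set_val st.1 + 1), st.2)) H) => //.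
  apply: cts_pair; last exact: (@cts_snd I I I id (@cts_id I)).
  by apply: (@cts_fst _ _ _ (fun t : I => clamp (-1 * set_val t + 1)));
    exact: scale_clamp_continuous.
- by move=> s; rewrite H0 /mk_path /path_rev_fun mulN1r addrC.
- by move=> s; rewrite H1 /mk_path /path_rev_fun mulN1r addrC.
- by move=> t; rewrite unitI0 val_clamp ?lexx ?ler01 // mulr0 add0r -unitI1.
- by move=> t; rewrite unitI1 val_clamp ?lexx ?ler01 // mulr1 addNr -unitI0.
Qed.

(* Two reparametrizations of one path that agree at 0 and at 1 are homotopic;
   u and v need only be defined up to clamping. *)
Lemma path_reparam_homotopic x y a b (f : path x y) (g k : path a b)
    (u v : I -> R) :
  continuous u -> continuous v ->
  (forall s, g s = f (clamp (u s))) -> (forall s, k s = f (clamp (v s))) ->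
  u zero = v zero -> u one = v one -> path_homotopic g k.
Proof.
move=> cu cv gE kE uv0 uv1.
exists (fun st => f (clamp (u st.1 + set_val st.2 * (v st.1 - u st.1)))); split => /=.
- pose w (st : I * I) : R := u st.1 + set_val st.2 * (v st.1 - u st.1).
  apply: (@cts_comp _ _ _ w (fun r => f (clamp r))); last first.
    by apply: (@cts_comp _ _ _ clamp f); [exact: clamp_continuous|exact: cts_fun].
  have c1 : continuous (fun st : I * I => u st.1) by exact: cts_fst.
  have c2 : continuous (fun st : I * I => v st.1) by exact: cts_fst.
  have c3 : continuous (fun st : I * I => set_val st.2 : R).
    by apply: cts_snd; exact: val_unitI_continuous.
  move=> st; apply: (@continuousD _ _ _ (fun st : I * I => u st.1)); first exact: c1.
  apply: (@continuousM _ _ (fun st : I * I => set_val st.2 : R)); first exact: c3.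
  by apply: (@continuousB _ _ _ (fun st : I * I => v st.1)); [exact: c2|exact: c1].
- by move=> s; rewrite unitI0 val_clamp ?lexx ?ler01 // mul0r addr0 gE.
- by move=> s; rewrite unitI1 val_clamp ?lexx ?ler01 // mul1r addrC subrK kE.
- by move=> t; rewrite uv0 subrr mulr0 addr0 -kE path_zero.
- by move=> t; rewrite uv1 subrr mulr0 addr0 -kE path_one.
Qed.

Lemma val_unitI0 : set_val (zero : I) = 0.
Proof. by rewrite unitI0 val_clamp ?lexx ?ler01. Qed.

Lemma val_unitI1 : set_val (one : I) = 1.
Proof. by rewrite unitI1 val_clamp ?lexx ?ler01. Qed.

Lemma clamp_le0 (r : R) : r <= 0 -> clamp r = clamp 0 :> I.
Proof.
move=> r0; apply: val_inj => /=; rewrite /clamp_val.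
have /min_idPl -> : (0 : R) <= 1 by lra.
have /min_idPl -> : r <= 1 by lra.
by rewrite maxxx; apply/max_idPl.
Qed.

Lemma clamp_ge1 (r : R) : 1 <= r -> clamp r = clamp 1 :> I.
Proof.
move=> r1; apply: val_inj => /=; rewrite /clamp_val.
by rewrite (min_idPr r1) minxx.
Qed.

Lemma path_concatA x y z w (f : path x y) (g : path y z) (k : path z w) :
  path_homotopic (path_concat f (path_concat g k)) (path_concat (path_concat f g) k).
Proof.
apply: (@path_reparam_homotopic _ _ _ _ (path_concat f (path_concat g k)) _ _
  (fun s => 1 * set_val s + 0)
  (fun s => Num.min (Num.min (2 * set_val s + 0) (1 * set_val s + 4^-1))
     (2^-1 * set_val s + 2^-1))).
- exact: affine_unitI_continuous.
- move=> s; apply: (@continuous_min _ _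
    (fun s : I => Num.min (2 * set_val s + 0) (1 * set_val s + 4^-1))
    (fun s : I => 2^-1 * set_val s + 2^-1)).
    by apply: (@continuous_min _ _ (fun s : I => 2 * set_val s + 0)
      (fun s : I => 1 * set_val s + 4^-1)); exact: affine_unitI_continuous.
  exact: affine_unitI_continuous.
- by move=> s; rewrite mul1r addr0 clampK.
- move=> s; rewrite !path_concatE.
  have /andP[s0 s1] := unitI_itv s; move: s0 s1; set r : R := set_val s => r0 r1.
  have vc (q : R) : 0 <= q -> q <= 1 -> set_val (clamp q : I) = q.
    by move=> *; apply: val_clamp; apply/andP.
  case: (leP r (2^-1 : R)) => h1.
    rewrite (vc (2 * r)); [|lra|lra].
    case: (leP (2 * r) (2^-1 : R)) => h2.
      have -> : Num.min (Num.min (2 * r + 0) (1 * r + 4^-1)) (2^-1 * r + 2^-1) = 2 * r.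
        by rewrite (@min_l _ _ (2 * r + 0)) ?(@min_l _ _ (2 * r + 0)); lra.
      by rewrite vc; [|lra|lra]; rewrite h2.
    have -> : Num.min (Num.min (2 * r + 0) (1 * r + 4^-1)) (2^-1 * r + 2^-1) = r + 4^-1.
      by rewrite (@min_r _ _ (2 * r + 0)) ?(@min_l _ _ (1 * r + _)); lra.
    rewrite (vc (r + _)); [|lra|lra].
    have -> : (r + 4^-1 <= 2^-1) = false by apply/negbTE; rewrite -ltNge; lra.
    rewrite vc; [|lra|lra].
    have -> : (2 * (r + 4^-1) - 1 <= 2^-1) by lra.
    by congr (g (clamp _)); lra.
  have -> : Num.min (Num.min (2 * r + 0) (1 * r + 4^-1)) (2^-1 * r + 2^-1) = 2^-1 * r + 2^-1.
    by rewrite (@min_r _ _ (2 * r + 0)) ?(@min_r _ _ (1 * r + _)); lra.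
  rewrite (vc (2^-1 * r + _)); [|lra|lra].
  have -> : (2^-1 * r + 2^-1 <= 2^-1) = false by apply/negbTE; rewrite -ltNge; lra.
  rewrite vc; [|lra|lra].
  have -> : (2 * (2^-1 * r + 2^-1) - 1 <= 2^-1) = false by apply/negbTE; rewrite -ltNge; lra.
  by congr (k (clamp _)); lra.
- by rewrite val_unitI0 !mulr0 !add0r !min_l; lra.
- by rewrite val_unitI1 !min_r; lra.
Qed.

Lemma path_concat_constl x y (f : path x y) :
  path_homotopic (path_concat (path_const x) f) f.
Proof.
apply: (@path_reparam_homotopic _ _ _ _ f _ _
  (fun s => Num.max 0 (2 * set_val s + -1)) (fun s => 1 * set_val s + 0)).
- move=> s; apply: (@continuous_max _ _ (cst 0) (fun s : I => 2 * set_val s + -1)).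
    exact: cst_continuous.
  exact: affine_unitI_continuous.
- exact: affine_unitI_continuous.
- move=> s; rewrite path_concatE /=; case: (leP (set_val s) (2^-1 : R)) => h.
    by rewrite max_l; [rewrite -unitI0 path_zero|lra].
  by rewrite max_r //; lra.
- by move=> s; rewrite mul1r addr0 clampK.
- by rewrite val_unitI0 max_l; lra.
- by rewrite val_unitI1 max_r; lra.
Qed.

Lemma path_concat_constr x y (f : path x y) :
  path_homotopic (path_concat f (path_const y)) f.
Proof.
apply: (@path_reparam_homotopic _ _ _ _ f _ _
  (fun s => Num.min 1 (2 * set_val s + 0)) (fun s => 1 * set_val s + 0)).
- move=> s; apply: (@continuous_min _ _ (cst 1) (fun s : I => 2 * set_val s + 0)).
    exact: cst_continuous.
  exact: affine_unitI_continuous.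
- exact: affine_unitI_continuous.
- move=> s; rewrite path_concatE /=; case: (leP (set_val s) (2^-1 : R)) => h.
    by rewrite min_r ?addr0 //; lra.
  by rewrite min_l; [rewrite -unitI1 path_one|lra].
- by move=> s; rewrite mul1r addr0 clampK.
- by rewrite val_unitI0 min_r; lra.
- by rewrite val_unitI1 min_l; lra.
Qed.

Lemma path_concat_rev x y (f : path x y) :
  path_homotopic (path_concat f (path_rev f)) (path_const x).
Proof.
apply: (@path_reparam_homotopic _ _ _ _ f _ _
  (fun s => Num.min (2 * set_val s + 0) (-2 * set_val s + 2)) (cst 0)).
- move=> s; apply: (@continuous_min _ _ (fun s : I => 2 * set_val s + 0)
     (fun s : I => -2 * set_val s + 2)); exact: affine_unitI_continuous.
- exact: cst_continuous.
- move=> s; rewrite path_concatE !path_revE.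
  have /andP[s0 s1] := unitI_itv s; move: s0 s1; set r : R := set_val s => r0 r1.
  case: (leP r (2^-1 : R)) => h.
    by rewrite min_l ?addr0 //; lra.
  rewrite val_clamp; last by apply/andP; split; lra.
  by rewrite min_r; [congr (f (clamp _))|]; lra.
- by move=> s; rewrite /= -unitI0 path_zero.
- by rewrite val_unitI0 /= min_l; lra.
- by rewrite val_unitI1 /= min_r; lra.
Qed.

Lemma path_rev_concat x y (f : path x y) :
  path_homotopic (path_concat (path_rev f) f) (path_const y).
Proof.
apply: (@path_reparam_homotopic _ _ _ _ f _ _
  (fun s => Num.max (-2 * set_val s + 1) (2 * set_val s + -1)) (cst 1)).
- move=> s; apply: (@continuous_max _ _ (fun s : I => -2 * set_val s + 1)
     (fun s : I => 2 * set_val s + -1)); exact: affine_unitI_continuous.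
- exact: cst_continuous.
- move=> s; rewrite path_concatE !path_revE.
  have /andP[s0 s1] := unitI_itv s; move: s0 s1; set r : R := set_val s => r0 r1.
  case: (leP r (2^-1 : R)) => h.
    rewrite val_clamp; last by apply/andP; split; lra.
    by rewrite max_l; [congr (f (clamp _))|]; lra.
  by rewrite max_r //; lra.
- by move=> s; rewrite /= -unitI1 path_one.
- by rewrite val_unitI0 /= max_l; lra.
- by rewrite val_unitI1 /= max_r; lra.
Qed.

End Paths.

Section FundamentalGroup.
Context {R : realType} {X : topologicalType} (x : X).
Local Notation loop := (@pathType (unitI R) X x x).

Definition loop_homotopic (f g : loop) : bool := `[< path_homotopic f g >].

Lemma loop_homotopic_equiv : equiv_class_of loop_homotopic.
Proof.
split=> [f|f g|g f k].
- by apply/asboolP; exact: path_homotopic_refl.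
- by apply/asbool_equiv_eq; split; exact: path_homotopic_sym.
- by move=> /asboolP fg /asboolP gk; apply/asboolP; exact: path_homotopic_trans fg gk.
Qed.

Canonical loop_homotopic_equivRel := EquivRelPack loop_homotopic_equiv.
Canonical loop_homotopic_encModRel := defaultEncModRel loop_homotopic.

Definition pi1 := {eq_quot loop_homotopic}.

HB.instance Definition _ : EqQuotient loop loop_homotopic pi1 := EqQuotient.on pi1.
HB.instance Definition _ := Choice.on pi1.

Lemma pi1_eqP (f g : loop) : (\pi_pi1 f = \pi_pi1 g) <-> path_homotopic f g.
Proof.
split=> [/eqmodP /asboolP //|fg].
by apply/eqmodP/asboolP.
Qed.

Definition pi1_mul (a b : pi1) : pi1 := \pi_pi1 (path_concat (repr a) (repr b)).
Definition pi1_inv (a : pi1) : pi1 := \pi_pi1 (path_rev (repr a)).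
Definition pi1_one : pi1 := \pi_pi1 (path_const x).

Lemma pi1_repr_homotopic (f : loop) : path_homotopic (repr (\pi_pi1 f)) f.
Proof. by apply/pi1_eqP; rewrite reprK. Qed.

Lemma pi1_mul_pi (f g : loop) :
  pi1_mul (\pi_pi1 f) (\pi_pi1 g) = \pi_pi1 (path_concat f g).
Proof.
by apply/pi1_eqP; apply: path_concat_homotopic; exact: pi1_repr_homotopic.
Qed.

Lemma pi1_inv_pi (f : loop) : pi1_inv (\pi_pi1 f) = \pi_pi1 (path_rev f).
Proof. by apply/pi1_eqP; apply: path_rev_homotopic; exact: pi1_repr_homotopic. Qed.

Lemma pi1_mulA : associative pi1_mul.
Proof.
elim/quotW => f; elim/quotW => g; elim/quotW => k.
rewrite (pi1_mul_pi g k) (pi1_mul_pi f g) !pi1_mul_pi; apply/pi1_eqP.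
exact: path_concatA.
Qed.

Lemma pi1_mul1 : left_id pi1_one pi1_mul.
Proof.
by elim/quotW => f; rewrite pi1_mul_pi; apply/pi1_eqP; exact: path_concat_constl.
Qed.

Lemma pi1_mulr1 : right_id pi1_one pi1_mul.
Proof.
by elim/quotW => f; rewrite pi1_mul_pi; apply/pi1_eqP; exact: path_concat_constr.
Qed.

Lemma pi1_mulV : left_inverse pi1_one pi1_inv pi1_mul.
Proof.
elim/quotW => f; rewrite pi1_inv_pi pi1_mul_pi; apply/pi1_eqP.
exact: path_rev_concat.
Qed.

Lemma pi1_mulrV : right_inverse pi1_one pi1_inv pi1_mul.
Proof.
elim/quotW => f; rewrite pi1_inv_pi pi1_mul_pi; apply/pi1_eqP.
exact: path_concat_rev.
Qed.

HB.instance Definition _ :=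
  isGroup.Build pi1 pi1_mulA pi1_mul1 pi1_mulr1 pi1_mulV pi1_mulrV.

End FundamentalGroup.
Arguments pi1 R {X} x.

Section InducedMap.
Context {R : realType} {X Y : topologicalType} (f : continuousType X Y).
Context {x : X} {y : Y} (fxy : f x = y).
Local Notation I := (unitI R).

Lemma path_image_continuous (g : @pathType I X x x) : continuous (f \o g).
Proof. exact: cts_fun. Qed.

Lemma path_image0 (g : @pathType I X x x) : (f \o g) zero = y.
Proof. by rewrite /= path_zero. Qed.

Lemma path_image1 (g : @pathType I X x x) : (f \o g) one = y.
Proof. by rewrite /= path_one. Qed.

Definition path_image (g : @pathType I X x x) : @pathType I Y y y :=
  mk_path (@path_image_continuous g) (path_image0 g) (path_image1 g).

Lemma path_imageE g t : path_image g t = f (g t).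
Proof. by []. Qed.

Lemma path_image_homotopic g k :
  path_homotopic g k -> path_homotopic (path_image g) (path_image k).
Proof.
case=> H [cH H0 H1 Hx Hy]; exists (f \o H); split=> /= [|s|s|t|t].
- by apply: cts_comp => //; exact: cts_fun.
- by rewrite H0.
- by rewrite H1.
- by rewrite Hx.
- by rewrite Hy.
Qed.

Definition pi1_map (a : pi1 R x) : pi1 R y := \pi_(pi1 R y) (path_image (repr a)).

Lemma pi1_map_pi g : pi1_map (\pi_(pi1 R x) g) = \pi_(pi1 R y) (path_image g).
Proof.
by apply/pi1_eqP; apply: path_image_homotopic; exact: pi1_repr_homotopic.
Qed.

Lemma pi1_mapM : {morph pi1_map : a b / (a * b)%g}.
Proof.
elim/quotW => g; elim/quotW => k.
rewrite [(_ * _)%g in LHS]pi1_mul_pi !pi1_map_pi [RHS]pi1_mul_pi; congr (\pi _).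
by apply/path_eqP => t; rewrite path_imageE !path_concatE; case: ifP.
Qed.

Lemma pi1_map1 : pi1_map 1%g = 1%g.
Proof.
rewrite [LHS]pi1_map_pi; congr (\pi _).
by apply/path_eqP => t; rewrite path_imageE.
Qed.

HB.instance Definition _ := isUMagmaMorphism.Build (pi1 R x) (pi1 R y) pi1_map
  (pi1_map1, pi1_mapM).

End InducedMap.

Section SpecialLinear.
Context {n : nat} {F : comUnitRingType}.

Record SL := MkSL { SLval :> 'M[F]_n; _ : \det SLval == 1 }.

HB.instance Definition _ := [isSub for SLval].
HB.instance Definition _ := [Choice of SL by <:].

Lemma SL_det (A : SL) : \det A = 1.
Proof. by case: A => A /= /eqP. Qed.

Lemma SL_unit (A : SL) : SLval A \in unitmx.
Proof. by rewrite unitmxE SL_det unitr1. Qed.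

Lemma SL_one_subproof : \det (1%:M : 'M[F]_n) == 1.
Proof. by rewrite det1. Qed.

Lemma SL_mul_subproof (A B : SL) : \det (A *m B) == 1.
Proof. by rewrite det_mulmx !SL_det mulr1. Qed.

Lemma SL_inv_subproof (A : SL) : \det (invmx A) == 1.
Proof. by rewrite det_inv SL_det invr1. Qed.

Definition SL_one := MkSL SL_one_subproof.
Definition SL_mul A B := MkSL (SL_mul_subproof A B).
Definition SL_inv A := MkSL (SL_inv_subproof A).

Lemma SL_mulA : associative SL_mul.
Proof. by move=> A B C; apply: val_inj; rewrite /= mulmxA. Qed.

Lemma SL_mul1 : left_id SL_one SL_mul.
Proof. by move=> A; apply: val_inj; rewrite /= mul1mx. Qed.

Lemma SL_mulr1 : right_id SL_one SL_mul.
Proof. by move=> A; apply: val_inj; rewrite /= mulmx1. Qed.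

Lemma SL_mulV : left_inverse SL_one SL_inv SL_mul.
Proof. by move=> A; apply: val_inj; rewrite /= mulVmx ?SL_unit. Qed.

Lemma SL_mulrV : right_inverse SL_one SL_inv SL_mul.
Proof. by move=> A; apply: val_inj; rewrite /= mulmxV ?SL_unit. Qed.

HB.instance Definition _ :=
  isGroup.Build SL SL_mulA SL_mul1 SL_mulr1 SL_mulV SL_mulrV.
End SpecialLinear.
Arguments SL n F : clear implicits.

Section NormalClosure.
Context {G : groupType}.

Definition normal_subgroup (N : set G) : Prop :=
  [/\ N 1%g, forall a b, N a -> N b -> N (a * b)%g, forall a, N a -> N a^-1%g &
      forall a b, N a -> N (a ^ b)%g].

Definition normal_closure (A : set G) : set G :=
  [set g | forall N, normal_subgroup N -> A `<=` N -> N g].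

Lemma normal_closure_normal A : normal_subgroup (normal_closure A).
Proof.
split=> [N [] //|a b Na Nb N hN AN|a Na N hN AN|a b Na N hN AN].
- by have [_ NM _ _] := hN; apply: NM; [exact: Na|exact: Nb].
- by have [_ _ NV _] := hN; apply: NV; exact: Na.
- by have [_ _ _ NJ] := hN; apply: NJ; exact: Na.
Qed.

Context (A : set G).

Definition coset_eq (a b : G) : bool := `[< normal_closure A (a^-1 * b)%g >].

Lemma coset_eq_equiv : equiv_class_of coset_eq.
Proof.
have [N1 NM NV NJ] := normal_closure_normal A.
have sym a b : coset_eq a b -> coset_eq b a.
  by move=> /asboolP /NV; rewrite invgM invgK => h; apply/asboolP.
split=> [a|a b|a b c].
- by apply/asboolP; rewrite mulVg.
- by apply/idP/idP; exact: sym.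
- move=> /asboolP ab /asboolP bc; apply/asboolP.
  by have := NM _ _ ab bc; rewrite -mulgA mulVKg.
Qed.

Canonical coset_eq_equivRel := EquivRelPack coset_eq_equiv.
Canonical coset_eq_encModRel := defaultEncModRel coset_eq.

Definition quot_nclosure := {eq_quot coset_eq}.
Local Notation Q := quot_nclosure.

HB.instance Definition _ : EqQuotient G coset_eq Q := EqQuotient.on Q.
HB.instance Definition _ := Choice.on Q.

Lemma quot_nclosure_eqP a b : (\pi_Q a = \pi_Q b) <-> normal_closure A (a^-1 * b)%g.
Proof.
split=> [/eqmodP /asboolP //|h].
by apply/eqmodP/asboolP.
Qed.

Definition quot_mul (u v : Q) : Q := \pi_Q (repr u * repr v)%g.
Definition quot_inv (u : Q) : Q := \pi_Q (repr u)^-1%g.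
Definition quot_one : Q := \pi_Q 1%g.

Lemma quot_repr a : normal_closure A ((repr (\pi_Q a))^-1 * a)%g.
Proof. by apply/quot_nclosure_eqP; rewrite reprK. Qed.

Lemma quot_mul_pi a b : quot_mul (\pi_Q a) (\pi_Q b) = \pi_Q (a * b)%g.
Proof.
have [N1 NM NV NJ] := normal_closure_normal A.
apply/quot_nclosure_eqP; have := quot_repr a; have := quot_repr b.
set b' := repr _; set a' := repr _ => hb ha.
have -> : ((a' * b')^-1 * (a * b) = (a'^-1 * a) ^ b' * (b'^-1 * b))%g.
  by rewrite conjgE invgM !mulgA mulgK.
by apply: NM => //; exact: NJ.
Qed.

Lemma quot_inv_pi a : quot_inv (\pi_Q a) = \pi_Q a^-1%g.
Proof.
have [N1 NM NV NJ] := normal_closure_normal A.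
apply/quot_nclosure_eqP; have := quot_repr a; set a' := repr _ => ha.
have -> : ((a'^-1)^-1 * a^-1 = (a'^-1 * a)^-1 ^ a'^-1)%g.
  by rewrite conjgE invgM !invgK !mulgA mulgK.
by apply: NJ; exact: NV.
Qed.

Lemma quot_mulA : associative quot_mul.
Proof.
elim/quotW => a; elim/quotW => b; elim/quotW => c.
by rewrite (quot_mul_pi b c) (quot_mul_pi a b) !quot_mul_pi mulgA.
Qed.

Lemma quot_mul1 : left_id quot_one quot_mul.
Proof. by elim/quotW => a; rewrite quot_mul_pi mul1g. Qed.

Lemma quot_mulr1 : right_id quot_one quot_mul.
Proof. by elim/quotW => a; rewrite quot_mul_pi mulg1. Qed.

Lemma quot_mulV : left_inverse quot_one quot_inv quot_mul.
Proof. by elim/quotW => a; rewrite quot_inv_pi quot_mul_pi mulVg. Qed.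

Lemma quot_mulrV : right_inverse quot_one quot_inv quot_mul.
Proof. by elim/quotW => a; rewrite quot_inv_pi quot_mul_pi mulgV. Qed.

HB.instance Definition _ :=
  isGroup.Build Q quot_mulA quot_mul1 quot_mulr1 quot_mulV quot_mulrV.

Lemma quot_nclosure_piM a b : \pi_Q (a * b)%g = (\pi_Q a * \pi_Q b)%g.
Proof. by rewrite [RHS]quot_mul_pi. Qed.

End NormalClosure.

Lemma cts_mx (X : topologicalType) (R : realType) m n (f : X -> 'M[R]_(m, n)) :
  (forall i j, continuous (fun x => f x i j)) -> continuous f.
Proof.
move=> cf x A [P Pf PA]; rewrite nbhs_simpl /=.
have : \forall y \near x, forall i j, P i j (f y i j).
  apply: filter_forall => i; apply: filter_forall => j.
  exact: (cf i j x (P i j) (Pf i j)).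
by apply: filterS => y Py; exact: PA.
Qed.

Section SingularHomology.
Context (R : realType).

Definition std_simplex (n : nat) : set 'rV[R]_n.+1 :=
  [set v | (forall i, 0 <= v ord0 i) /\ \sum_i v ord0 i = 1].
Arguments std_simplex : clear implicits.

Section Face.
Context (n : nat) (i : 'I_n.+2).

Definition face_row (v : 'rV[R]_n.+1) : 'rV[R]_n.+2 :=
  \row_j if unlift i j is Some k then v ord0 k else 0.

Lemma face_subproof (v : std_simplex n) : face_row (set_val v) \in std_simplex n.+1.
Proof.
have [v0 v1] := set_valP v; apply/mem_set; split.
  by move=> j; rewrite mxE; case: unlift => // k; exact: v0.
rewrite (bigD1 i) //= mxE unlift_none add0r -v1.
rewrite (reindex_onto (fintype.lift i) (fun j => odflt ord0 (unlift i j))) /=.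
  apply: eq_big => [k|k _]; first by rewrite liftK eqxx andbT eq_sym neq_lift.
  by rewrite mxE liftK.
by move=> j ji; case: unliftP ji => [k ->|->] //=; rewrite eqxx.
Qed.

Definition face (v : std_simplex n) : std_simplex n.+1 :=
  exist _ (face_row (set_val v)) (face_subproof v).

Lemma face_continuous : continuous face.
Proof.
apply: continuous_comp_initial.
rewrite -[_ \o _]/(fun v => face_row (set_val v)).
apply: cts_mx => a j.
under eq_fun do rewrite mxE.
case: unlift => [k|]; last exact: cst_continuous.
apply: (@cts_comp _ _ _ set_val (fun v : 'rV[R]_n.+1 => v ord0 k)).
  exact: initial_continuous.
exact: coord_continuous.
Qed.

HB.instance Definition _ := isContinuous.Build _ _ face face_continuous.
End Face.

Context (X : topologicalType).

Definition singular_simplex (n : nat) := continuousType (std_simplex n) X.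
Definition singular_chain (n : nat) := {freeg (singular_simplex n) / int}.

Definition simplex_boundary n (s : singular_simplex n.+1) : singular_chain n :=
  \sum_(i < n.+2) << (-1) ^+ i *g (s \o face i : singular_simplex n) >>.

Definition boundary n : singular_chain n.+1 -> singular_chain n :=
  fglift (@simplex_boundary n).

HB.instance Definition _ n := GRing.isZmodMorphism.Build _ _ (@boundary n)
  (lift_is_additive (@simplex_boundary n)).

Definition is_cycle n : pred (singular_chain n) :=
  if n is m.+1 return pred (singular_chain n) then fun c => boundary c == 0
  else predT.

Lemma is_cycle_zmod_closed n : zmod_closed (@is_cycle n).
Proof.
case: n => [|n] //; split; rewrite ?unfold_in /= ?raddf0 // => c d.
rewrite !unfold_in /= => /eqP hc /eqP hd.
by rewrite raddfB /= hc hd subrr.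
Qed.

HB.instance Definition _ n :=
  GRing.isZmodClosed.Build (singular_chain n) (@is_cycle n) (@is_cycle_zmod_closed n).

Record singular_cycle n := SingularCycle { cycle_val :> singular_chain n; _ : is_cycle cycle_val }.
HB.instance Definition _ n := [isSub for @cycle_val n].
HB.instance Definition _ n := [Choice of singular_cycle n by <:].
HB.instance Definition _ n := [SubChoice_isSubZmodule of singular_cycle n by <:].

(* Boundaries are taken inside the group of cycles, so the quotient below makes
   sense without the identity boundary \o boundary = 0. *)
Definition is_boundary n : pred (singular_cycle n) :=
  fun z => `[< exists c : singular_chain n.+1, boundary c = val z >].

Lemma is_boundary_zmod_closed n : zmod_closed (@is_boundary n).
Proof.
split=> [|z w]; rewrite !unfold_in.
  by apply/asboolP; exists 0; rewrite !raddf0.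
move=> /asboolP[c cz] /asboolP[d dw]; apply/asboolP.
by exists (c - d); rewrite !raddfB /= cz dw.
Qed.

HB.instance Definition _ n :=
  GRing.isZmodClosed.Build (singular_cycle n) (@is_boundary n) (@is_boundary_zmod_closed n).

Definition homology (n : nat) : zmodType :=
  Quotient.quot (GRing.ZmodClosed.clone (singular_cycle n) (@is_boundary n) _).

End SingularHomology.
Arguments std_simplex R n : clear implicits.

Section Hurewicz.
Context {R : realType} {X : topologicalType} {x : X}.
Local Notation loop := (@pathType (unitI R) X x x).

Definition simplex1_param (v : std_simplex R 1) : unitI R :=
  clamp (set_val v ord0 ord_max).

Lemma simplex1_param_continuous : continuous simplex1_param.
Proof.
apply: (@cts_comp _ _ _ (fun v : std_simplex R 1 => set_val v ord0 ord_max) clamp);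
  last exact: clamp_continuous.
apply: (@cts_comp _ _ _ set_val (fun v : 'rV[R]_2 => v ord0 ord_max)).
  exact: initial_continuous.
exact: coord_continuous.
Qed.

HB.instance Definition _ :=
  isContinuous.Build _ _ simplex1_param simplex1_param_continuous.

Definition loop_simplex (f : loop) : singular_simplex R X 1 := f \o simplex1_param.

Lemma loop_simplex_cycle (f : loop) : is_cycle (<< loop_simplex f >> : singular_chain R X 1).
Proof.
rewrite /is_cycle /boundary liftU scale1r /simplex_boundary.
rewrite big_ord_recl big_ord1 /= expr0 expr1.
set s0 := (X in << 1 *g X >>); set s1 := (X in << -1 *g X >>).
suff -> : s0 = s1 by rewrite -freegUN subrr.
have val1 (v : std_simplex R 0) : set_val v ord0 ord0 = 1.
  by have [_] := set_valP v; rewrite big_ord1.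
apply/continuousEP => v; rewrite /s0 /s1 /= /loop_simplex /= /simplex1_param.
have -> : set_val (face ord0 v) ord0 ord_max = 1.
  rewrite set_valE /= mxE; case: unliftP => [k _|//].
  by rewrite [k]ord1 val1.
have -> : set_val (face (fintype.lift ord0 ord0) v) ord0 ord_max = 0.
  rewrite set_valE /= mxE; case: unliftP => [k /(congr1 val)|//].
  by rewrite [k]ord1.
by rewrite -unitI1 -unitI0 path_one path_zero.
Qed.

(* The homology class of a loop; it does not depend on the representative
   chosen by repr. *)
Definition hurewicz (g : pi1 R x) : homology R X 1 :=
  \pi_(homology R X 1) (SingularCycle (loop_simplex_cycle (repr g))).

End Hurewicz.

Definition homeomorphic (X Y : topologicalType) : Prop :=
  exists (f : continuousType X Y) (g : continuousType Y X), cancel f g /\ cancel g f.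

Section Manifolds.
Context (R : realType).

Definition locally_euclidean (d : nat) (X : topologicalType) : Prop :=
  forall x : X, exists U : set X, [/\ open U, U x & homeomorphic U 'rV[R]_d].

Definition closed_manifold (d : nat) (X : topologicalType) : Prop :=
  [/\ hausdorff_space X, @second_countable X, compact [set: X] &
      locally_euclidean d X].

Definition sqnorm {d : nat} (v : 'rV[R]_d) : R := \sum_i v ord0 i ^+ 2.

Definition unit_sphere (d : nat) : set 'rV[R]_d.+1 := [set v | sqnorm v = 1].
Arguments unit_sphere : clear implicits.

Definition integral_homology_sphere (d : nat) (X : topologicalType) : Prop :=
  closed_manifold d X /\
  forall k, exists f : {additive homology R X k -> homology R (unit_sphere d) k},
    bijective f.

End Manifolds.
Arguments unit_sphere R d : clear implicits.

Section Knots.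
Context {R : realType} {S : topologicalType}.
Local Notation circle := (set_type (unit_sphere R 1)).

Definition is_knot (K : set S) : Prop :=
  exists k : continuousType circle S, injective k /\ range k = K.

(* An open embedding h of S^1 x R^2 with core K; the open tubular neighbourhood
   is the image of S^1 x (open unit disc). Taking h on all of S^1 x R^2 forces
   K to be tame and the neighbourhood to have a collared boundary torus. *)
Definition tubular_chart (K : set S) (h : circle * 'rV[R]_2 -> S) : Prop :=
  [/\ continuous h, injective h, forall U, open U -> open (h @` U) &
      h @` [set zv | zv.2 = 0] = K].

Definition tubular_nbhd (h : circle * 'rV[R]_2 -> S) : set S :=
  h @` [set zv | sqnorm zv.2 < 1].

Definition exterior (h : circle * 'rV[R]_2 -> S) : set S := ~` tubular_nbhd h.

(* A meridian: the boundary of a meridian disc z x D^2, joined to the base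
   point by an arc in the exterior. *)
Definition is_meridian (h : circle * 'rV[R]_2 -> S) (x0 : exterior h)
    (g : pi1 R x0) : Prop :=
  exists (z : circle) (y : exterior h)
    (arc : {path (unitI R) from x0 to y in set_type (exterior h)})
    (m : {path (unitI R) from y to y in set_type (exterior h)}),
    (forall t : unitI R, set_val (m t) =
       h (z, \row_(i < 2) if i == ord0 then cos (2 * pi * set_val t)
                          else sin (2 * pi * set_val t))) /\
    g = \pi_(pi1 R x0) (path_concat (path_concat arc m) (path_rev arc)).

End Knots.

Section Coverings.
Context {R : realType} {C E : topologicalType}.

Definition covering_map (p : C -> E) : Prop :=
  continuous p /\
  forall x : E, exists (U : set E) (sheets : set (set C)),
    [/\ open U /\ U x, p @^-1` U = \bigcup_(V in sheets) V,
        trivIset sheets id &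
        forall V, sheets V -> [/\ open V, set_inj V p, p @` V = U &
          forall W, open W -> W `<=` V -> open (p @` W)]].

(* p is the connected covering that corresponds to the kernel of
   pi_1(E) -> H_1(E) -> Z -> Z/n, where phi identifies H_1(E) with Z. *)
Definition cyclic_cover (phi : homology R E 1 -> int) (n : nat)
    (p : continuousType C E) (x0 : E) (y0 : C) (p0 : p y0 = x0) : Prop :=
  [/\ covering_map p, connected [set: C] &
      forall g : pi1 R x0,
        (exists c : pi1 R y0, pi1_map p0 c = g) <-> (n%:Z %| phi (hurewicz g))%Z].

End Coverings.

Section ComplexExponential.
Context {R : realType}.
Local Open Scope complex_scope.

Definition cexp (z : R[i]) : R[i] :=
  (expR (complex.Re z))%:C * (cos (complex.Im z) +i* sin (complex.Im z)).

End ComplexExponential.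

(* Main.v *)
Require Import Defs.
From HB Require Import structures.
From mathcomp Require Import all_boot all_order all_algebra generic_quotient.
From mathcomp Require Import ring_quotient freeg complex.
From mathcomp Require Import all_classical all_reals all_analysis homotopy.
From mathcomp Require Import lra.
Import Order.TTheory GRing.Theory Num.Theory numFieldNormedType.Exports.

(** Write zeta for exp(i pi / n) and deg for the degree phi (hurewicz (p_* gamma))
of a loop gamma of the cover.  The assignment gamma |-> zeta ^ (k deg gamma) is a
character of pi_1(C_n), because the Hurewicz map is a homomorphism
([hurewiczM]).  By the choice of the cover deg gamma is a multiple of n, and
zeta ^ n = -1 ([cexp_pi_div]); so the character takes the values 1 and -1 only,
and twisting rho o p_* by it stays inside SL_2, as the determinant is multiplied
by the square of the character ([SL_twist]).

The loop mu_n lies over mu ^ n, which has degree n.  Its image is therefore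
zeta ^ (n k) rho(mu) ^ n = (-1) ^ k (-1) ^ k = 1, and a homomorphism that kills
mu_n factors through the quotient by its normal closure
([quot_nclosure_lift]).

The topological part is that the Hurewicz map is a homomorphism in degree one.
The product of two classes is represented by a loop that is only homotopic to
the concatenation of their representatives, so two facts are needed: homotopic
loops are homologous ([loop_homotopic_homologous]) and a concatenation is
homologous to the sum of its two factors ([path_concat_homologous]).  Each comes
from explicit singular triangles, whose edges are read off by
[loop_triangle]. *)

Local Open Scope classical_set_scope.
Local Open Scope ring_scope.
Local Open Scope quotient_scope.
Local Open Scope complex_scope.

(** * Singular triangles with prescribed edges *)

Section Triangles.
Context {R : realType} {X : topologicalType}.

(** The last two barycentric coordinates serve as affine coordinates: the
vertices of the simplex become (0, 0), (1, 0) and (0, 1). *)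
Definition triangle_fun (Q : R * R -> X) (v : std_simplex R 2) : X :=
  Q (set_val v ord0 (inord 1), set_val v ord0 ord_max).

Lemma triangle_continuous (Q : R * R -> X) :
  continuous Q -> continuous (triangle_fun Q).
Proof.
move=> cQ; apply: (@cts_comp _ _ _ (fun v : std_simplex R 2 =>
  (set_val v ord0 (inord 1), set_val v ord0 ord_max)) Q) => //.
have cc (j : 'I_3) : continuous (fun v : std_simplex R 2 => set_val v ord0 j).
  apply: (@cts_comp _ _ _ set_val (fun v : 'rV[R]_3 => v ord0 j)).
    exact: initial_continuous.
  exact: coord_continuous.
by apply: cts_pair; exact: cc.
Qed.

Definition triangle (Q : R * R -> X) (cQ : continuous Q) : singular_simplex R X 2 :=
  HB.pack_for (continuousType (std_simplex R 2) X) (triangle_fun Q)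
    (isContinuous.Build _ _ (triangle_fun Q) (triangle_continuous Q cQ)).

(** Face i omits vertex i, so in the affine coordinates the edges e0, e1 and e2 are
opposite to (0, 0), (1, 0) and (0, 1); the parameter of an edge is its last
barycentric coordinate, hence it runs towards the later vertex. *)
Lemma boundary_triangle (Q : R * R -> X) (cQ : continuous Q)
    (e0 e1 e2 : singular_simplex R X 1) :
  (forall v, e0 v = Q (1 - set_val v ord0 ord_max, set_val v ord0 ord_max)) ->
  (forall v, e1 v = Q (0, set_val v ord0 ord_max)) ->
  (forall v, e2 v = Q (set_val v ord0 ord_max, 0)) ->
  boundary << triangle Q cQ >> = << e0 >> - << e1 >> + << e2 >> :> singular_chain R X 1.
Proof.
move=> E0 E1 E2.
have faceE (i : 'I_3) (k : 'I_2) (v : std_simplex R 1) :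
    set_val (face i v) ord0 (fintype.lift i k) = set_val v ord0 k.
  by rewrite set_valE /= mxE liftK.
have face0 (i : 'I_3) (v : std_simplex R 1) : set_val (face i v) ord0 i = 0.
  by rewrite set_valE /= mxE unlift_none.
have sum1 (v : std_simplex R 1) : set_val v ord0 ord0 = 1 - set_val v ord0 ord_max.
  have [_] := set_valP v; rewrite big_ord_recl big_ord1.
  rewrite (_ : fintype.lift ord0 ord0 = ord_max); last exact: val_inj.
  by move=> <-; rewrite addrK.
have i1 : inord 1 = fintype.lift ord0 ord0 :> 'I_3.
  by apply: val_inj; rewrite /= inordK.
rewrite /boundary liftU scale1r /simplex_boundary.
rewrite !big_ord_recl big_ord0 addr0 /= expr0 expr1 sqrrN expr1n -freegUN addrA.
congr (<< _ >> - << _ >> + << _ >>); apply/continuousEP => v /=.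
- rewrite E0 -sum1 /triangle_fun i1 faceE.
  rewrite (_ : ord_max = fintype.lift ord0 ord_max) ?faceE //; exact: val_inj.
- rewrite E1 /triangle_fun i1 face0.
  rewrite [in X in Q (_, X)](_ : ord_max =
    fintype.lift (fintype.lift ord0 ord0) ord_max) ?faceE //.
  exact: val_inj.
- rewrite E2 /triangle_fun; congr (Q (_, _)).
    rewrite (_ : inord 1 =
      fintype.lift (fintype.lift ord0 (fintype.lift ord0 ord0)) ord_max) ?faceE //.
    by apply: val_inj; rewrite /= inordK.
  rewrite (_ : ord_max = fintype.lift ord0 (fintype.lift ord0 ord0) :> 'I_3) ?face0 //.
  exact: val_inj.
Qed.

End Triangles.

(** * The Hurewicz homomorphism in degree one *)

Section HurewiczMorphism.
Context {R : realType} {X : topologicalType} {x : X}.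
Local Notation I := (unitI R).
Local Notation loop := (@pathType I X x x).

(** The form of [boundary_triangle] used below: all singular triangles needed for
the Hurewicz map send their three vertices to the base point, so that their
edges are loops. *)
Lemma loop_triangle (Q : R * R -> X) (cQ : continuous Q) (f0 f1 f2 : loop) :
  (forall t : I, f0 t = Q (1 - set_val t, set_val t)) ->
  (forall t : I, f1 t = Q (0, set_val t)) ->
  (forall t : I, f2 t = Q (set_val t, 0)) ->
  exists c : singular_chain R X 2,
    boundary c = << loop_simplex f0 >> - << loop_simplex f1 >> + << loop_simplex f2 >>.
Proof.
have paramE (v : std_simplex R 1) :
    set_val (simplex1_param v) = set_val v ord0 ord_max.
  have [v0] := set_valP v; rewrite big_ord_recl big_ord1 => v1.
  rewrite /simplex1_param val_clamp // v0 /= -v1.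
  rewrite (_ : fintype.lift ord0 ord0 = ord_max) ?lerDr //; exact: val_inj.
move=> E0 E1 E2; exists << triangle Q cQ >>; apply: boundary_triangle => v /=.
- by rewrite E0 paramE.
- by rewrite E1 paramE.
- by rewrite E2 paramE.
Qed.

Lemma homology_eq n (z w : singular_cycle R X n) :
  (exists c : singular_chain R X n.+1, boundary c = val z - val w) ->
  \pi_(homology R X n) z = \pi_(homology R X n) w.
Proof.
move=> [c cE]; apply/eqP; rewrite -Quotient.idealrBE; apply/asboolP.
by exists c; rewrite cE raddfB.
Qed.

(** The diagonal d of the square cuts a homotopy H from f to g into two triangles.
Both have d and the constant loop, to which H restricts on the vertical
sides, among their edges; these cancel in the difference of the triangles and
leave f - g. *)
Lemma loop_homotopic_homologous (f g : loop) : path_homotopic f g ->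
  exists c : singular_chain R X 2,
    boundary c = << loop_simplex f >> - << loop_simplex g >>.
Proof.
case=> H [cH H0 H1 Hx Hy].
have cl := @clamp_continuous R.
have cfst : continuous (fun ab : R * R => clamp ab.1 : I) by exact: cts_fst.
have csnd : continuous (fun ab : R * R => clamp ab.2 : I) by exact: cts_snd.
have cadd : continuous (fun ab : R * R => clamp (ab.1 + ab.2) : I).
  apply: (@cts_comp _ _ _ (fun ab : R * R => ab.1 + ab.2) clamp) => // ab.
  by apply: continuousD; [exact: cvg_fst|exact: cvg_snd].
have cdiag : continuous (fun t : I => H (t, t)).
  apply: (@cts_comp _ _ _ (fun t : I => (t, t)) H) => //.
  by apply: cts_pair; exact: cts_id.
pose d : loop := mk_path cdiag (Hx _) (Hy _).
have c1 : continuous (fun ab : R * R => H (clamp (ab.1 + ab.2), clamp ab.2)).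
  by apply: cts_comp cH; exact: cts_pair.
have c2 : continuous (fun ab : R * R => H (clamp ab.2, clamp (ab.1 + ab.2))).
  by apply: cts_comp cH; exact: cts_pair.
have [||| t1 t1E] := loop_triangle _ c1 (path_const x) d f => [t|t|t|] /=.
- by rewrite subrK -unitI1 Hy.
- by rewrite add0r clampK.
- by rewrite addr0 clampK -unitI0 H0.
have [||| t2 t2E] := loop_triangle _ c2 g d (path_const x) => [t|t|t|] /=.
- by rewrite subrK clampK -unitI1 H1.
- by rewrite add0r clampK.
- by rewrite addr0 -unitI0 Hx.
exists (t1 - t2); rewrite raddfB /= t1E t2E.
set d' : singular_chain R X 1 := << loop_simplex d >>; set c' := << _ >>.
by rewrite (addrC (c' - d')) -(addrA _ (- d')) (addrC (- d')) opprD addrACA subrr addr0.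
Qed.

(** This frees computations of [hurewicz] from the representative that [repr] picks,
which is only known up to homotopy. *)
Lemma hurewicz_pi (f : loop) : hurewicz (\pi_(pi1 R x) f) =
  \pi_(homology R X 1) (SingularCycle (loop_simplex_cycle f)).
Proof.
apply: homology_eq => /=; apply: loop_homotopic_homologous.
exact: pi1_repr_homotopic.
Qed.

(** Project the triangle linearly onto the interval, its vertices going to 0, 1/2
and 1, and compose with the concatenation of f and g: the edges are then f, g
and the concatenation. *)
Lemma path_concat_homologous (f g : loop) :
  exists c : singular_chain R X 2,
    boundary c = << loop_simplex (path_concat f g) >>
      - (<< loop_simplex f >> + << loop_simplex g >>).
Proof.
have cQ : continuous (fun ab : R * R => path_concat f g (clamp (2^-1 * ab.1 + ab.2))).
  apply: (@cts_comp _ _ _ (fun ab : R * R => clamp (2^-1 * ab.1 + ab.2)) (path_concat f g)).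
    apply: (@cts_comp _ _ _ (fun ab : R * R => 2^-1 * ab.1 + ab.2) clamp).
      move=> ab; apply: (@continuousD _ _ _ (fun ab : R * R => 2^-1 * ab.1) snd).
        apply: (@continuousM _ _ (cst 2^-1) fst); first exact: cst_continuous.
        exact: cvg_fst.
      exact: cvg_snd.
    exact: clamp_continuous.
  exact: cts_fun.
have [t|t|t|c cE] := loop_triangle _ cQ g (path_concat f g) f.
- rewrite path_concatE /=; have /andP[t0 t1] := unitI_itv t.
  rewrite val_clamp; last by apply/andP; split; lra.
  case: leP => h.
    (* Only the common point of the two halves of the concatenation is left. *)
    have tE : set_val t = 0 by lra.
    rewrite -[t in LHS]clampK tE (_ : 2 * _ = 1); last by lra.
    by rewrite -unitI0 -unitI1 path_zero path_one.
  by rewrite -[t in LHS]clampK; congr (g (clamp _)); lra.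
- by rewrite mulr0 add0r clampK.
- rewrite path_concatE /=; have /andP[t0 t1] := unitI_itv t.
  rewrite val_clamp; last by apply/andP; split; lra.
  case: leP => h; last by exfalso; lra.
  by rewrite -[t in LHS]clampK; congr (f (clamp _)); lra.
exists (- c); rewrite raddfN /= cE.
by rewrite addrAC opprB [X in _ - X]addrC.
Qed.

Lemma hurewiczM (a b : pi1 R x) : hurewicz (a * b)%g = hurewicz a + hurewicz b.
Proof.
elim/quotW: a => f; elim/quotW: b => g.
rewrite [(_ * _)%g]pi1_mul_pi !hurewicz_pi -raddfD /=.
by apply: homology_eq => /=; exact: path_concat_homologous.
Qed.

End HurewiczMorphism.

(** * Homomorphisms out of the quotient by a normal closure *)

Section QuotientLift.
Context {G H : groupType} (A : set G) (f : UMagmaMorphism.type G H).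
Hypothesis fA : forall a, A a -> f a = 1%g.

(** The kernel of f is one of the normal subgroups over which the closure is an
intersection. *)
Lemma normal_closure_ker g : normal_closure A g -> f g = 1%g.
Proof.
move=> Ng; apply: (Ng [set g | f g = 1%g]) => //; split=> /= [|a b fa fb|a fa|a b fa].
- exact: gmulf1.
- by rewrite gmulfM fa fb mulg1.
- by rewrite gmulfV fa invg1.
- by rewrite gmulfJ fa conj1g.
Qed.

Definition quot_lift (q : quot_nclosure A) : H := f (repr q).

Lemma quot_lift_pi g : quot_lift (\pi g) = f g.
Proof.
have /normal_closure_ker := @quot_repr _ A g.
rewrite gmulfM gmulfV => fg; apply: (mulgI (quot_lift (\pi g))^-1%g).
by rewrite mulVg -fg.
Qed.

Lemma quot_lift1 : quot_lift 1%g = 1%g.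
Proof. by apply: etrans (quot_lift_pi 1%g) _; exact: gmulf1. Qed.

Lemma quot_liftM : {morph quot_lift : u v / (u * v)%g}.
Proof.
elim/quotW => a; elim/quotW => b.
by rewrite -quot_nclosure_piM !quot_lift_pi gmulfM.
Qed.

HB.instance Definition _ :=
  isUMagmaMorphism.Build (quot_nclosure A) H quot_lift (quot_lift1, quot_liftM).

Lemma quot_nclosure_lift :
  exists Psi : UMagmaMorphism.type (quot_nclosure A) H, forall g, Psi (\pi g) = f g.
Proof. by exists quot_lift => g; exact: quot_lift_pi. Qed.

End QuotientLift.

(** * Twisting a representation by a character *)

Section Twist.
Context {G : groupType} {m : nat} {F : comUnitRingType}.
Context (rho : UMagmaMorphism.type G (SL m F)) (c : G -> F).
Hypothesis cM : forall a b, c (a * b)%g = c a * c b.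
Hypothesis c_root : forall a, c a ^+ m = 1.

(** Scaling by c a multiplies the determinant by c a ^+ m, so an m-torsion character
is what keeps the twist in SL m. *)
Lemma twist_subproof a : \det (c a *: SLval (rho a)) == 1.
Proof. by rewrite detZ c_root SL_det mulr1. Qed.

Definition twist a : SL m F := MkSL (twist_subproof a).

Lemma twistM : {morph twist : a b / (a * b)%g}.
Proof.
move=> a b; apply: val_inj => /=.
by rewrite cM gmulfM /= -scalemxAl -scalemxAr scalerA.
Qed.

Lemma twist1 : twist 1%g = 1%g.
Proof. by apply: (mulgI (twist 1)); rewrite -twistM !mulg1. Qed.

HB.instance Definition _ := isUMagmaMorphism.Build G (SL m F) twist (twist1, twistM).

Lemma SL_twist : exists Phi : UMagmaMorphism.type G (SL m F),
  forall a, SLval (Phi a) = c a *: SLval (rho a).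
Proof. by exists twist. Qed.

End Twist.

Lemma SLvalX m (F : comUnitRingType) (A : SL m.+1 F) n :
  SLval (A ^+ n)%g = SLval A ^+ n.
Proof. by elim: n => [|n IHn]; rewrite ?expg0 ?expr0 // expgS exprS -IHn. Qed.

(** * The 2n-th root of unity *)

Section RootsOfUnity.
Context {R : realType}.

(** De Moivre's formula, by the addition formulas for cos and sin. *)
Lemma cexp_imaginaryX (t : R) n :
  cexp (t%:C * 'i) ^+ n = cos (n%:R * t) +i* sin (n%:R * t) :> R[i].
Proof.
have cexpE : cexp (t%:C * 'i) = cos t +i* sin t.
  by rewrite /cexp /= mulr0 mul0r subrr expR0 mulr1 mul0r addr0 mul1r.
elim: n => [|n IHn]; first by rewrite expr0 mul0r cos0 sin0.
rewrite exprS IHn cexpE -natr1 mulrDl mul1r addrC.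
by rewrite cosD sinD; apply/eqP; rewrite eq_complex /= eqxx addrC eqxx.
Qed.

Lemma cexp_pi_div n : (0 < n)%N -> cexp ((pi / n%:R : R)%:C * 'i) ^+ n = -1 :> R[i].
Proof.
move=> n0; rewrite cexp_imaginaryX mulrC divfK ?pnatr_eq0 -?lt0n //.
by rewrite cospi sinpi; apply/eqP; rewrite eq_complex /= oppr0 !eqxx.
Qed.

End RootsOfUnity.

(** * The induced representation of the branched cover *)

Theorem proposition5p6 (R : realType)
  (Sigma : topologicalType) (hSigma : integral_homology_sphere R 3 Sigma)
  (K : set Sigma) (hK : is_knot (R := R) K)
  (h : set_type (unit_sphere R 1) * 'rV[R]_2 -> Sigma) (hh : tubular_chart K h)
  (x0 : exterior h) (mu : pi1 R x0) (hmu : is_meridian mu)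
  (phi : {additive homology R (exterior h) 1 -> int})
  (phi_bij : bijective phi) (phi_mu : phi (hurewicz mu) = 1)
  (n k : nat) (hn : (2 <= n)%N) (hk : (k <= n)%N)
  (C : topologicalType) (p : continuousType C (exterior h)) (y0 : C)
  (p0 : p y0 = x0) (hp : cyclic_cover phi n p0)
  (mu_n : pi1 R y0) (hmu_n : pi1_map p0 mu_n = (mu ^+ n)%g)
  (rho : UMagmaMorphism.type (pi1 R x0) (SL 2 R[i]))
  (htr : \tr (SLval (rho mu)) = (2 * cos (k%:R * pi / n%:R))%:C)
  (hpow : SLval (rho mu) ^+ n = (- 1%:M) ^+ k) :
  exists Phi : UMagmaMorphism.type (pi1 R y0) (SL 2 R[i]),
    [/\ forall gamma : pi1 R y0,
          SLval (Phi gamma) =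
            (cexp ((pi / n%:R)%:C * 'i) ^ phi (hurewicz (pi1_map p0 gamma))) ^+ k
              *: SLval (rho (pi1_map p0 gamma)),
        SLval (Phi mu_n) = 1%:M &
        exists Psi : UMagmaMorphism.type (quot_nclosure [set mu_n]) (SL 2 R[i]),
          forall gamma : pi1 R y0, Psi (\pi_(quot_nclosure [set mu_n]) gamma) = Phi gamma].
Proof.
set zeta := cexp _; pose deg g := phi (hurewicz (pi1_map p0 g)).
have zetan : zeta ^+ n = -1 by apply: cexp_pi_div; exact: leq_trans hn.
have zeta0 : zeta != 0.
  apply/eqP => z0; move/eqP: zetan; rewrite z0 expr0n (gtn_eqF (leq_trans _ hn)) //.
  by rewrite eq_sym oppr_eq0 oner_eq0.
pose c g := (zeta ^ deg g) ^+ k.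
have cM a b : c (a * b)%g = c a * c b.
  by rewrite /c /deg pi1_mapM hurewiczM raddfD expfzDr // exprMn.
have c_root a : c a ^+ 2 = 1.
  (* deg a = j n, so zeta ^ deg a = (-1) ^ j is its own inverse. *)
  have [_ _ cover] := hp.
  have /dvdzP[j degE] : (n%:Z %| deg a)%Z by apply/cover; exists a.
  rewrite /c degE mulrC -exprz_exp -exprnP zetan.
  by rewrite exprAC [(_ ^ j) ^+ 2]exprnP exprz_exp mulrC -exprz_exp -exprnP sqrrN
    expr1n exp1rz expr1n.
have [Phi PhiE] := SL_twist (rho \o pi1_map p0) c cM c_root.
have degX m : phi (hurewicz (mu ^+ m)%g) = m%:Z.
  elim: m => [|m IHm]; last first.
    by rewrite expgS hurewiczM raddfD /= IHm phi_mu.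
  (* The degree of the unit loop is 0 since 1 * 1 = 1. *)
  apply: (addIr (phi (hurewicz (mu ^+ 0)%g))).
  by rewrite -raddfD -hurewiczM mulg1 add0r.
have Phi_mu : SLval (Phi mu_n) = 1%:M.
  rewrite PhiE /= hmu_n gmulfXn SLvalX hpow /c /deg hmu_n degX -exprnP zetan.
  have -> : (- 1%:M : 'M[R[i]]_2) ^+ k = (-1) ^+ k *: 1%:M.
    by rewrite idmxE -scaleN1r exprZn expr1n.
  by rewrite scalerA -exprMn mulrNN mulr1 expr1n scale1r.
exists Phi; split=> //.
apply: quot_nclosure_lift => _ ->; exact: val_inj.
Qed.
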